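(* Let $k\ge 1$ be an integer and let $a,b$ be integers. The circulant digraph $\mathrm{Cay}(\mathbb{Z}_{2k}; a, b, b+k)$ has a hamiltonian circuit if and only if $\gcd(a,b,k)=1$ and at least one of the following holds: (i) $\gcd(a-b,k)\neq 1$; (ii) $\gcd(a,2k)=1$; (iii) $\gcd(b,k)=1$; (iv) both $a$ and $k$ are even; (v) $a$ is odd, and either $b$ or $k$ is odd.
   Context: For a natural number $n$, $\mathbb{Z}_n$ denotes the additive cyclic group of integers modulo $n$. For a set $A$ of integers, $\mathrm{Cay}(\mathbb{Z}_n; A)$ is the digraph with vertex set $\mathbb{Z}_n$ having an arc from $u$ to $u+c \pmod n$ for every $u\in\mathbb{Z}_n$ and every $c\in A$; we write $\mathrm{Cay}(\mathbb{Z}_n; c_1,c_2,c_3)$ for $\mathrm{Cay}(\mathbb{Z}_n;\{c_1,c_2,c_3\})$. A hamiltonian circuit is a directed cycle passing through every vertex exactly once. *)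

(* Defs.v *)
From mathcomp Require Import all_boot all_order all_algebra.

Set Implicit Arguments.
Unset Strict Implicit.
Unset Printing Implicit Defensive.

Import GRing.Theory.
Local Open Scope ring_scope.

(* The connection set is given by a finite list of integers; only membership
   in the list matters.  ['Z_n] is the ring of integers modulo n for n > 1 only
   (it is ['Z_2] for n = 0 and n = 1). *)
Definition Cay (n : nat) (A : seq int) : rel 'Z_n :=
  fun u v => has (fun c : int => v == u + c%:~R) A.

(* The circuit is the list of its vertices in order, with the arc from the last
   vertex back to the first included in [cycle]; a circuit of length 2 is
   allowed, and a circuit of length 1 would need a loop. *)
Definition hamiltonian_circuit (T : finType) (e : rel T) (s : seq T) : Prop :=
  [/\ cycle e s, uniq s & forall x : T, x \in s].

Definition has_hamiltonian_circuit (T : finType) (e : rel T) : Prop :=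
  exists s : seq T, hamiltonian_circuit e s.

(* Main.v *)
Require Import Defs.
From mathcomp Require Import all_boot all_order all_algebra fingroup perm.
From mathcomp Require Import zify ring.

(* A hamiltonian circuit is a cyclic permutation s of Z_2k whose arcs lie in the
   digraph.  The number of arcs of length a leaving a pair {v, v + k} is
   constant along the cosets of a - b in Z_k.

   If gcd(a - b, k) <> 1, let one coset send one such arc from each pair and the
   others none.  In a pair without such arcs the two images can be exchanged,
   so exchanges may be used to merge cycles; when no more merging is possible,
   the cycles are invariant under k, b and a - b, hence there is only one.

   If gcd(a - b, k) = 1, this number is 0, 1 or 2 for all pairs.  The values 0
   and 2 give (iii) and (ii).  For the value 1, contracting the pairs turns s
   into a choice, at every vertex of the 2-in 2-out digraph Cay(Z_k; a, b),
   between the two ways of matching the entering with the leaving arcs.  The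
   choices that come from Z_2k have a fixed parity on each coset of a, and the
   parity of s is determined, which yields the necessity of (iv) or (v).
   Conversely, when the parity is right, take an admissible choice with the
   fewest cycles, an odd number.  If this number is at least 3, then two
   vertices of a coset of a that are visited by two cycles are visited by the
   same two, since changing both choices would otherwise save two cycles.  It
   follows that a coset of a with such a vertex is a cycle of its own followed
   straight on.  Changing the choice at two of its vertices keeps the number of
   cycles, but breaks this property. *)

Set Implicit Arguments.
Unset Strict Implicit.
Unset Printing Implicit Defensive.

Import GRing.Theory Num.Theory.

(** * Cycles of permutations *)

Section Cycles.
Local Open Scope group_scope.

Lemma porbit_step (T : finType) (s : {perm T}) (x : T) :
  porbit s (s x) = porbit s x.
Proof. exact: (porbit_perm s 1 x). Qed.

Lemma porbit_closed (T : finType) (s : {perm T}) (x y : T) :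
  y \in porbit s x -> s y \in porbit s x.
Proof. by rewrite -!eq_porbit_mem porbit_step. Qed.

Lemma porbit_ind (T : finType) (s : {perm T}) (x : T) (P : T -> Prop) :
    P x -> (forall y, y \in porbit s x -> P y -> P (s y)) ->
  forall y, y \in porbit s x -> P y.
Proof.
move=> Px IH y /porbitP [n ->] {y}.
elim: n => [|n IHn]; first by rewrite expg0 perm1.
by rewrite expgSr permM; apply: IH => //; rewrite mem_porbit.
Qed.

Lemma card_porbits_merge (T : finType) (s : {perm T}) (x y : T) :
  porbit s x != porbit s y -> #|porbits (tperm x y * s)|.+1 = #|porbits s|.
Proof.
move=> nxy; have := porbits_mul_tperm s x y.
have -> : x != y by apply: contra nxy => /eqP ->.
by rewrite -eq_porbit_mem nxy /=; lia.
Qed.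

Lemma card_porbits_split (T : finType) (s : {perm T}) (x y : T) :
    x != y -> porbit s x = porbit s y ->
  #|porbits (tperm x y * s)| = #|porbits s|.+1.
Proof.
move=> nxy exy; have := porbits_mul_tperm s x y.
by rewrite nxy -eq_porbit_mem exy eqxx /=; lia.
Qed.

Lemma porbit_tperm_out (T : finType) (s : {perm T}) (x y u : T) :
    u \notin porbit s x -> u \notin porbit s y ->
  porbit (tperm x y * s) u = porbit s u.
Proof.
move=> ux uy; apply/porbit_setP => v.
suffices E n : ((tperm x y * s) ^+ n) u = (s ^+ n) u.
  by apply/porbitP/porbitP => -[n ->]; exists n; rewrite E.
elim: n => [|n IHn]; first by rewrite !expg0.
rewrite !expgSr !permM IHn tpermD //.
  by apply: contra ux => /eqP ->; rewrite porbit_sym mem_porbit.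
by apply: contra uy => /eqP ->; rewrite porbit_sym mem_porbit.
Qed.

(** A cycle through neither [x] nor [y] survives the exchange unchanged, so it cannot absorb another
    one. *)
Lemma porbit_tperm_merged (T : finType) (s : {perm T}) (x y p q : T) :
    porbit s p != porbit s q ->
    porbit (tperm x y * s) p = porbit (tperm x y * s) q ->
  (porbit s p == porbit s x) || (porbit s p == porbit s y).
Proof.
move=> npq epq; rewrite !eq_porbit_mem; apply: contraNT npq.
rewrite negb_or => /andP[px py].
have := porbit_tperm_out px py; rewrite epq => E.
by rewrite eq_sym eq_porbit_mem -E porbit_id.
Qed.

(* Each exchange that joins two cycles lowers their number, so a choice with
   the fewest cycles joins every exchangeable pair. *)
Lemma exists_swapped_perm (T : finType) (s0 : {perm T}) (i : T -> T)
    (P : pred T) (hi : involutive i) (hP : forall v, P (i v) = P v) :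
  exists s : {perm T},
    (forall v, s v = s0 v \/ P v /\ s v = s0 (i v)) /\
    (forall v, P v -> porbit s (i v) = porbit s v).
Proof.
pose good (s : {perm T}) :=
  [forall v, (s v == s0 v) || P v && (s v == s0 (i v))].
have good0 : good s0 by apply/forallP => v; rewrite eqxx.
case: (arg_minnP (fun s : {perm T} => #|porbits s|) good0) => s gs min_s.
exists s; split => [v|v Pv].
  have /forallP/(_ v)/orP[/eqP|/andP[? /eqP]] := gs; by [left|right].
apply/eqP/negPn/negP => nv.
have /min_s : good (tperm (i v) v * s).
  apply/forallP => w; rewrite permM; case: tpermP => [->|->|_ _].
  - have /forallP/(_ v) := gs; rewrite hi hP Pv /=.
    by rewrite orbC.
  - have /forallP/(_ (i v)) := gs; rewrite hi hP Pv /=.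
    by rewrite orbC.
  - exact: (forallP gs).
by rewrite -(card_porbits_merge nv) ltnn.
Qed.

(** As [x] and [y] are distinct, both pairs consist of exactly these two. *)
Lemma pred2_sub (T : eqType) (x y z c1 c2 d1 d2 : T) : x != y ->
    x \in pred2 c1 c2 -> y \in pred2 c1 c2 ->
    x \in pred2 d1 d2 -> y \in pred2 d1 d2 ->
  z \in pred2 d1 d2 -> z \in pred2 c1 c2.
Proof.
rewrite !inE => nxy /orP[]/eqP ? /orP[]/eqP ? /orP[]/eqP ? /orP[]/eqP ?; subst;
  by rewrite ?eqxx // in nxy *; rewrite orbC.
Qed.

(** * Circuits through a 2-in 2-out digraph *)

Section Eulerian.

Variables (I : finType) (al be : {perm I}).
Hypothesis commute_ab : forall i, al (be i) = be (al i).
Hypothesis transitive_ab :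
  forall i j, exists m n, j = (al ^+ m) ((be ^+ n) i).

Implicit Types (f : {ffun I -> bool}) (i j : I).

Definition step_fun f (v : I * bool) : I * bool :=
  let u := v.2 (+) f v.1 in (if u then al v.1 else be v.1, u).

Lemma step_fun_inj f : injective (step_fun f).
Proof.
move=> [i t] [j u]; rewrite /step_fun /= => -[+ e]; rewrite -e.
by case: ifP => _ /perm_inj ij; rewrite ij in e *; rewrite (addIb e).
Qed.

(* A state [(i, t)] is a visit of vertex [i] through the arc coming from
   [al^-1 i] (if [t]) or from [be^-1 i]; the visit leaves through the arc of the
   other kind exactly when [f i]. *)
Definition step f : {perm (I * bool)} := perm (@step_fun_inj f).

Lemma stepE f v : step f v = step_fun f v.
Proof. exact: permE. Qed.

Definition toggle i f : {ffun I -> bool} := [ffun j => f j (+) (j == i)].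

Lemma toggleK i : involutive (toggle i).
Proof. by move=> f; apply/ffunP => j; rewrite !ffunE addbK. Qed.

Lemma toggleC i j f : toggle i (toggle j f) = toggle j (toggle i f).
Proof. by apply/ffunP => l; rewrite !ffunE addbAC. Qed.

(** The two visits of [i] trade exits, so every toggle either merges two cycles or splits one. *)
Lemma step_toggle i f :
  step (toggle i f) = tperm (i, true) (i, false) * step f.
Proof.
apply/permP => -[j t]; rewrite permM !stepE /step_fun /= ffunE.
case: (eqVneq j i) => [->|nij].
  by rewrite addbT addbN -addNb; case: t; rewrite ?tpermL ?tpermR.
rewrite tpermD ?addbF //=; by apply: contraNneq nij => -[->].
Qed.

Definition visitA f i := porbit (step f) (i, true).
Definition visitB f i := porbit (step f) (i, false).
Definition split_at f i := visitA f i != visitB f i.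
Definition ncycles f := #|porbits (step f)|.

Lemma step_straight f i : f i = false ->
  visitA f (al i) = visitA f i /\ visitB f (be i) = visitB f i.
Proof.
by move=> fi; rewrite /visitA /visitB -[in RHS]porbit_step
  -[in X in _ /\ _ = X]porbit_step !stepE /step_fun /= fi.
Qed.

Lemma step_cross f i : f i = true ->
  visitA f (al i) = visitB f i /\ visitB f (be i) = visitA f i.
Proof.
by move=> fi; rewrite /visitA /visitB -[in RHS]porbit_step
  -[in X in _ /\ _ = X]porbit_step !stepE /step_fun /= fi.
Qed.

Lemma visitA_al f i :
  visitA f (al i) = visitA f i \/ visitA f (al i) = visitB f i.
Proof.
case fi: (f i); [right|left].
  by have [] := step_cross fi.
by have [] := step_straight fi.
Qed.

Lemma visitB_be f i :
  visitB f (be i) = visitA f i \/ visitB f (be i) = visitB f i.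
Proof.
case fi: (f i); [left|right].
  by have [] := step_cross fi.
by have [] := step_straight fi.
Qed.

Lemma ncycles_toggle_split f i :
  split_at f i -> (ncycles (toggle i f)).+1 = ncycles f.
Proof. by move=> Di; rewrite /ncycles step_toggle card_porbits_merge. Qed.

Lemma ncycles_toggle_joined f i :
  ~~ split_at f i -> ncycles (toggle i f) = (ncycles f).+1.
Proof.
move=> /negPn/eqP Di; rewrite /ncycles step_toggle card_porbits_split //.
by apply/eqP => -[].
Qed.

(** The [be]-arc out of [i] lies on [C], so the other cycle at [i] leaves by the [al]-arc. A
    crossing further on would send it out along a [be]-arc, so it runs straight around the whole
    orbit. *)
Lemma constant_exit f i C : split_at f i ->
    (forall j, j \in porbit al i -> visitB f (be j) = C) ->
  forall j, j \in porbit al i -> f j = false /\ visitB f j = C.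
Proof.
move=> Di BC.
have Ci := BC i (porbit_id _ _).
have nC : visitA f (al i) != C.
  case fi: (f i); [have [a b] := step_cross fi|have [a b] := step_straight fi];
  by rewrite a -Ci b // eq_sym.
pose P j := [/\ visitA f (al j) = visitA f (al i), f (al j) = false &
                visitB f (al j) = C].
have next j : j \in porbit al i -> visitA f (al j) = visitA f (al i) -> P j.
  move=> /porbit_closed jX ej; have Cj := BC _ jX.
  case fj: (f (al j)).
    have [_ b] := step_cross fj.
    by move: nC; rewrite -ej -b Cj eqxx.
  by have [_ b] := step_straight fj; rewrite /P -b.
have all_P j : j \in porbit al i -> P j.
  move=> jX; apply: porbit_ind (jX) => [|y yX [ey fy _]].
    by apply: next => //; apply: porbit_id.
  apply: next; first exact: porbit_closed.
  by rewrite -ey; have [-> _] := step_straight fy.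
move=> j jX; have /all_P [] : al^-1 j \in porbit al i.
  by rewrite -eq_porbit_mem -porbit_step permKV eq_porbit_mem.
by rewrite permKV.
Qed.

Lemma ncycles_connected f : (forall i, ~~ split_at f i) -> ncycles f <= 1.
Proof.
move=> nD.
have Aal i : visitA f (al i) = visitA f i.
  by have [->|->] := visitA_al f i => //; have /negPn/eqP := nD i.
have Abe i : visitA f (be i) = visitA f i.
  have /negPn/eqP -> := nD (be i); have /negPn/eqP e := nD i.
  by have [->|->] := visitB_be f i.
have Aalm m i : visitA f ((al ^+ m) i) = visitA f i.
  by elim: m => [|m IH]; rewrite ?expg0 ?perm1 // expgSr permM Aal.
have Aben m i : visitA f ((be ^+ m) i) = visitA f i.
  by elim: m => [|m IH]; rewrite ?expg0 ?perm1 // expgSr permM Abe.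
apply/card_le1_eqP => _ _ /imsetP[[i t] _ ->] /imsetP[[j u] _ ->].
suffices: forall i t, porbit (step f) (i, t) = visitA f i.
  move=> E; rewrite !E; have [m [n ->]] := transitive_ab i j.
  by rewrite Aalm Aben.
by move=> {}i [] //; have /negPn/eqP := nD i.
Qed.

(** * Choices with the fewest cycles *)

Section Minimal.

Variable Q : pred {ffun I -> bool}.
Hypothesis toggle2 : forall f i, Q f -> Q (toggle i (toggle (al i) f)).

(** Double toggles at consecutive vertices of the orbit cancel except at the two ends. *)
Lemma toggle2_porbit f i j :
  Q f -> j \in porbit al i -> Q (toggle i (toggle j f)).
Proof.
move=> Qf jX; move: j jX; apply: porbit_ind => [|y _ Qy].
  by rewrite toggleK.
have := toggle2 y Qy.
by rewrite [toggle (al y) _]toggleC [toggle y _]toggleC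
  [toggle (al y) (toggle y f)]toggleC toggleK.
Qed.

Variable f : {ffun I -> bool}.
Hypothesis Qf : Q f.
Hypothesis min_f : forall f', Q f' -> ncycles f <= ncycles f'.

(** If [j] were still met by two cycles after toggling [i], toggling [j] too would save two cycles,
    against minimality. So toggling [i] merges the cycles at [j], and it can only merge those at
    [i]. *)
Lemma split_at_same i j : split_at f i -> split_at f j -> j \in porbit al i ->
  visitA f j \in pred2 (visitA f i) (visitB f i) /\
  visitB f j \in pred2 (visitA f i) (visitB f i).
Proof.
move=> Di Dj jX; have Qij := toggle2_porbit Qf jX.
have cij := min_f Qij.
have ci := ncycles_toggle_split Di.
have : ~~ split_at (toggle i f) j.
  by apply/negP => /ncycles_toggle_split; rewrite toggleC; lia.
rewrite negbK /visitA /visitB step_toggle => /eqP e.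
split; first exact: porbit_tperm_merged e.
by apply: porbit_tperm_merged (esym e); rewrite eq_sym.
Qed.

(** Induction along the orbit: the [al]-arc into [al j] continues a cycle of [j], and the second
    visit of [al j] is on the same cycle or covered by [split_at_same]. *)
Lemma visits_in_pair i j : split_at f i -> j \in porbit al i ->
  visitA f j \in pred2 (visitA f i) (visitB f i) /\
  visitB f j \in pred2 (visitA f i) (visitB f i).
Proof.
move=> Di jX; move: j jX; apply: porbit_ind => [|j jX [Aj Bj]].
  by rewrite !inE !eqxx orbT.
have aA : visitA f (al j) \in pred2 (visitA f i) (visitB f i).
  by have [->|->] := visitA_al f j.
have [Daj|/negPn/eqP <- //] := boolP (split_at f (al j)).
by apply: split_at_same => //; exact: porbit_closed.
Qed.

Lemma porbit_be i j : j \in porbit al (be i) ->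
  exists2 j', j' \in porbit al i & j = be j'.
Proof.
move=> /porbitP[n ->]; exists ((al ^+ n) i); first exact: mem_porbit.
elim: n => [|n IHn]; first by rewrite expg0 !perm1.
by rewrite !expgSr !permM IHn commute_ab.
Qed.

Definition mixed i := exists2 j, j \in porbit al i & visitB f j != visitB f i.

(** Otherwise each vertex of the orbit is met by one cycle only, and the [al]-arcs carry this cycle
    around the orbit. *)
Lemma mixed_split i : mixed i -> exists2 j, j \in porbit al i & split_at f j.
Proof.
move=> [j jX nB]; have [/existsP[y /andP[yX Dy]]|nD] :=
  boolP [exists y, (y \in porbit al i) && split_at f y]; first by exists y.
have AB y : y \in porbit al i -> visitA f y = visitB f y.
  move=> yX; apply/eqP; move: nD; rewrite negb_exists => /forallP/(_ y).
  by rewrite yX negbK.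
case/eqP: nB; rewrite -!AB ?porbit_id //.
move: j jX; apply: porbit_ind => // y yX Ay.
by have [->|->] := visitA_al f y; rewrite -?AB.
Qed.

(** The [be]-arcs into the orbit of [be i] are those out of the orbit of [i], so [constant_exit]
    applies. *)
Lemma not_mixed_be i j : split_at f j -> j \in porbit al i -> ~ mixed (be i) ->
  forall y, y \in porbit al i -> f y = false /\ visitB f y = visitB f (be i).
Proof.
move=> Dj; rewrite -eq_porbit_mem => /eqP jX nm y; rewrite -jX => yX.
apply: constant_exit Dj _ y yX => y yX; apply/eqP/negPn/negP => nB.
case: nm; exists (be y) => //; rewrite jX in yX.
have [n ->] := porbitP _ _ _ yX.
suffices <- : (al ^+ n) (be i) = be ((al ^+ n) i) by exact: mem_porbit.
elim: (n) => [|m IHm]; first by rewrite expg0 !perm1.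
by rewrite !expgSr !permM IHm commute_ab.
Qed.

Lemma mixedP i : mixed i \/ ~ mixed i.
Proof.
have [/existsP[j /andP[? ?]]|nm] :=
  boolP [exists j, (j \in porbit al i) && (visitB f j != visitB f i)].
  by left; exists j.
by right => -[j jX nB]; case/existsP: nm; exists j; rewrite jX.
Qed.

(** A mixed orbit has a vertex met by two cycles, which must be [c1] and [c2]. Were the next orbit
    not mixed, [not_mixed_be] would put all [be]-arcs into this one on a single cycle. *)
Lemma mixed_be i c1 c2 : mixed i ->
    (forall j, j \in porbit al i -> visitB f j \in pred2 c1 c2) ->
  [/\ forall j, j \in porbit al i -> visitA f j \in pred2 c1 c2, mixed (be i) &
      forall j, j \in porbit al (be i) -> visitB f j \in pred2 c1 c2].
Proof.
move=> mi Bi; have [y yX Dy] := mixed_split mi.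
have eX : porbit al y = porbit al i by apply/eqP; rewrite eq_porbit_mem.
have Ai j : j \in porbit al i -> visitA f j \in pred2 c1 c2.
  case: mi => z zX nzi jX; have iX := porbit_id al i.
  apply: pred2_sub nzi (Bi _ zX) (Bi _ iX) _ _ (visits_in_pair Dy _).1;
    by [rewrite eX|apply: (visits_in_pair Dy _).2; rewrite eX].
split => //; first by case: (mixedP (be i)) => // nm; have E := not_mixed_be Dy yX nm;
  case: mi => z zX; rewrite (E z zX).2 (E i (porbit_id _ _)).2 eqxx.
move=> j /porbit_be[y' y'X ->].
by have [->|->] := visitB_be f y'; [exact: Ai|exact: Bi].
Qed.

(* The two cycles seen at [i] are the only ones on the next [al]-orbit, which
   again has entering [be]-arcs of both, so they are the only cycles. *)
Lemma crossing_ncycles i j :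
  split_at f i -> j \in porbit al i -> f j -> ncycles f <= 2.
Proof.
move=> Di jX fj; pose c1 := visitA f i; pose c2 := visitB f i.
have m1 : mixed (be i).
  have [//|nm] := mixedP (be i).
  by have [] := not_mixed_be Di (porbit_id _ _) nm jX; rewrite fj.
have B1 y : y \in porbit al (be i) -> visitB f y \in pred2 c1 c2.
  move=> /porbit_be[y' /(visits_in_pair Di)[Ay' By'] ->].
  by have [->|->] := visitB_be f y'.
have all_n n : mixed ((be ^+ n.+1) i) /\
    forall y, y \in porbit al ((be ^+ n.+1) i) -> visitB f y \in pred2 c1 c2.
  elim: n => [|n [mn Bn]]; first by rewrite expg1.
  by rewrite expgSr permM; have [_ ? ?] := mixed_be mn Bn.
have all_x x : visitA f x \in pred2 c1 c2 /\ visitB f x \in pred2 c1 c2.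
  have [m [n ->]] := transitive_ab i x.
  (* Only the orbits after that of [i] are known to be mixed, so [i] itself is reached by going once
     around [be]. *)
  have [n' ->] : exists n', (be ^+ n) i = (be ^+ n'.+1) i.
    case: n => [|n]; last by exists n.
    by exists #[be].-1; rewrite prednK ?order_gt0 // expg_order expg0.
  have [mn Bn] := all_n n'; have [An _ _] := mixed_be mn Bn.
  by split; [apply: An|apply: Bn]; rewrite mem_porbit.
apply: leq_trans (_ : #|[set c1; c2]| <= _); last by rewrite cards2; case: eqP.
apply/subset_leq_card/subsetP => _ /imsetP[[x t] _ ->].
by have [] := all_x x; rewrite /visitA /visitB !inE; case: t.
Qed.

End Minimal.

(* In a choice with the fewest cycles, a doubly visited vertex [i] lies on an
   [al]-orbit without crossings; toggling [i] and [al i] keeps the number of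
   cycles, and [al i] is then doubly visited and crossing. *)
Lemma exists_single_cycle (Q : pred {ffun I -> bool}) f0 :
    (forall f i, Q f -> Q (toggle i (toggle (al i) f))) ->
    (forall i, al i != i) -> (forall f, Q f -> odd (ncycles f)) -> Q f0 ->
  exists2 f, Q f & ncycles f = 1%N.
Proof.
move=> toggle2 al_free oddQ Qf0.
case: (arg_minnP ncycles Qf0) => f Qf min_f.
exists f => //; apply/eqP; rewrite eqn_leq; apply/andP; split; last first.
  by have := oddQ f Qf; case: ncycles.
rewrite leqNgt; apply/negP => n1.
have n3 : 2 < ncycles f by have := oddQ f Qf; move: n1; case: ncycles => [|[|[]]].
have crossing g i j : Q g -> (forall f', Q f' -> ncycles g <= ncycles f') ->
    split_at g i -> j \in porbit al i -> g j -> ncycles g <= 2.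
  by move=> Qg min_g Di jX gj; apply: (crossing_ncycles toggle2 Qg min_g Di jX gj).
have [i Di] : exists i, split_at f i.
  have [/existsP //|] := boolP [exists i, split_at f i].
  by rewrite negb_exists => /forallP /ncycles_connected; rewrite leqNgt n1.
have fal : f (al i) = false.
  apply/negP => /(crossing f i (al i) Qf min_f Di).
  by rewrite leqNgt n3 => /(_ (mem_porbit al 1 i)).
pose g := toggle i (toggle (al i) f).
have Qg : Q g by exact: toggle2.
have ci := ncycles_toggle_split Di.
have nD : ~~ split_at (toggle i f) (al i).
  apply/negP => /ncycles_toggle_split; rewrite toggleC -/g.
  by have := min_f _ Qg; lia.
have cg : ncycles g = ncycles f.
  by rewrite /g toggleC ncycles_toggle_joined ?ci.
(* Toggling [al i] in [g] gives back [toggle i f], which has one cycle fewer than [g]. *)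
have Dg : split_at g (al i).
  have [//|/ncycles_toggle_joined] := boolP (split_at g (al i)).
  by rewrite cg /g toggleC toggleK; lia.
have: ncycles g <= 2.
  apply: (crossing g (al i) (al i)) => //; first by move=> f'; rewrite cg; exact: min_f.
    exact: porbit_id.
  by rewrite !ffunE fal (negPf (al_free i)) eqxx.
by rewrite cg leqNgt n3.
Qed.

End Eulerian.

End Cycles.

(** * Parity of the step permutation *)

Section Parity.
Local Open Scope group_scope.

Lemma lift_side_inj (I : finType) (b : bool) (p : {perm I}) :
  injective (fun v : I * bool => (if v.2 == b then p v.1 else v.1, v.2)).
Proof.
move=> [i t] [j u] /= [+ ut]; rewrite -ut.
by case: ifP => _; [move=> /perm_inj ->|move=> ->].
Qed.

Definition lift_side (I : finType) (b : bool) (p : {perm I}) :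
  {perm (I * bool)} := perm (@lift_side_inj I b p).

Lemma lift_sideM (I : finType) (b : bool) (p q : {perm I}) :
  lift_side b (p * q) = lift_side b p * lift_side b q.
Proof.
apply/permP => -[i t]; rewrite !permM !permE /=.
by case: ifP => //; rewrite permM.
Qed.

Lemma lift_side_tperm (I : finType) (b : bool) (i j : I) :
  lift_side b (tperm i j) = tperm (i, b) (j, b).
Proof.
apply/permP => -[l t]; rewrite !permE /= !xpair_eqE.
case: eqP => [->|_]; last by rewrite !andbF.
by rewrite !andbT; do 2!case: ifP => // _.
Qed.

Lemma odd_lift_side (I : finType) (b : bool) (p : {perm I}) :
  odd_perm (lift_side b p) = odd_perm p.
Proof.
have [ts -> _] := prod_tpermP p; elim: ts => [|t ts IH].
  rewrite big_nil (_ : lift_side b 1 = 1) ?odd_perm1 //.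
  by apply/permP => -[i u]; rewrite permE !perm1 /= if_same.
rewrite big_cons lift_sideM !odd_permM IH lift_side_tperm !odd_tperm.
by rewrite xpair_eqE eqxx andbT.
Qed.

(** Each toggle is a transposition; without crossings, [step] is [al] on one copy of [I] and [be] on
    the other. *)
Lemma odd_step (I : finType) (al be : {perm I}) (f : {ffun I -> bool}) :
  odd_perm (step al be f) =
  odd (\sum_i f i) (+) (odd_perm al (+) odd_perm be).
Proof.
have [n] := ubnP (\sum_i f i); elim: n f => // n IH f le_n.
have [i fi|f0] := pickP f.
  have sum_f : (\sum_j f j = (\sum_j toggle i f j).+1)%N.
    rewrite (bigD1 i) // [in RHS](bigD1 i) //= ffunE fi eqxx /= add0n add1n.
    by congr _.+1; apply: eq_bigr => j /negPf nj; rewrite ffunE nj addbF.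
  have := IH (toggle i f); rewrite step_toggle odd_mul_tperm.
  have -> : (i, true) != (i, false) by apply/eqP => -[].
  rewrite sum_f /= in le_n * => /(_ le_n) e.
  by rewrite addNb -e negbK.
rewrite big1 => [|i _]; last by rewrite f0.
suffices -> : step al be f = lift_side true al * lift_side false be.
  by rewrite odd_permM !odd_lift_side.
by apply/permP => -[i [] ]; rewrite permM stepE !permE /step_fun /= f0 //= permE.
Qed.

End Parity.

(** * Hamiltonian circuits as cyclic permutations *)

Lemma ham_of_perm (T V : finType) (e : rel T) (s : {perm V}) (phi : V -> T)
    (x0 : V) (phi_inj : injective phi) (phi_surj : forall y, exists x, y = phi x)
    (arcs : forall v, e (phi v) (phi (s v)))
    (one : forall u v, porbit s u = porbit s v) :
  has_hamiltonian_circuit e.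
Proof.
exists (map phi (orbit s x0)); split.
- rewrite cycle_map; apply: (sub_cycle (e := frel s)).
    by move=> u v /= /eqP <-.
  exact: cycle_orbit perm_inj x0.
- by rewrite map_inj_uniq ?orbit_uniq.
- move=> y; have [x ->] := phi_surj y; rewrite mem_map // -fconnect_orbit.
  have : x \in porbit s x0 by rewrite (one x0 x) porbit_id.
  by case/porbitP => n ->; rewrite permX fconnect_iter.
Qed.

Lemma perm_of_ham (T : finType) (e : rel T) : has_hamiltonian_circuit e ->
  exists2 s : {perm T}, forall v, e v (s v) &
    forall u v, porbit s u = porbit s v.
Proof.
move=> [p [cyc_p uniq_p all_p]].
exists (perm (can_inj (prev_next uniq_p))) => [v|u v].
  by rewrite permE next_cycle.
apply/eqP; rewrite eq_porbit_mem porbit_sym; apply/porbitP.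
have : fconnect (next p) u v by rewrite (fconnect_cycle (cycle_next uniq_p)).
move=> /iter_findex uv; exists (findex (next p) u v).
by rewrite permX -[LHS]uv; apply: eq_iter => z; rewrite permE.
Qed.

Local Open Scope ring_scope.

(** * Integers modulo n *)

Lemma intr_Zp_eq0 (n : nat) (z : int) : (1 < n)%N ->
  (z%:~R == 0 :> 'Z_n) = (n %| z)%Z.
Proof.
move=> n_gt1.
have nat0 m : (m%:R == 0 :> 'Z_n) = (n %| m)%N.
  by rewrite -val_eqE /= val_Zp_nat.
case: z => m; first by rewrite -pmulrn nat0.
by rewrite NegzE mulrNz oppr_eq0 -pmulrn nat0 dvdzE abszN.
Qed.

Lemma intr_Zp_surj (n : nat) (x : 'Z_n) : x = (x : nat)%:Z%:~R.
Proof. by rewrite -pmulrn natr_Zp. Qed.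

(** Defined on representatives, so that the same map serves as the projection when [m] divides [n]
    and as a choice of preimages from ['Z_k] to ['Z_(2 * k)]. *)
Definition reduce (n m : nat) (x : 'Z_n) : 'Z_m := (x : nat)%:R.

Section Reduce.

Variables n m : nat.
Hypotheses (n_gt1 : (1 < n)%N) (m_gt1 : (1 < m)%N) (m_dvd_n : (m %| n)%N).

Lemma reduce_int (z : int) : reduce m (z%:~R : 'Z_n) = z%:~R.
Proof.
apply/eqP; rewrite /reduce pmulrn -subr_eq0 -mulrzBr intr_Zp_eq0 //.
apply: (@dvdz_trans n); first by rewrite dvdzE.
by rewrite -intr_Zp_eq0 // mulrzBr subr_eq0 -intr_Zp_surj.
Qed.

Lemma reduceD (x y : 'Z_n) : reduce m (x + y) = reduce m x + reduce m y.
Proof.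
rewrite (intr_Zp_surj x) (intr_Zp_surj y) -mulrzDr !reduce_int.
by rewrite mulrzDr.
Qed.

End Reduce.

(** * Functions invariant under shifts *)

Section ShiftInvariance.

Variables (n : nat) (T : Type) (F : 'Z_n -> T).

Definition shift_invariant (c : int) := forall v, F (v + c%:~R) = F v.

Lemma shift_invariantN c : shift_invariant c -> shift_invariant (- c).
Proof. by move=> Fc v; rewrite -[LHS]Fc mulrNz addrNK. Qed.

Lemma shift_invariantD c d :
  shift_invariant c -> shift_invariant d -> shift_invariant (c + d).
Proof. by move=> Fc Fd v; rewrite mulrzDr addrA Fd. Qed.

Lemma shift_invariantM c z : shift_invariant c -> shift_invariant (z * c).
Proof.
move=> Fc; have Fnat k : shift_invariant (k%:Z * c).
  elim: k => [|k IH]; first by move=> v; rewrite mul0r addr0.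
  by rewrite -addn1 PoszD mulrDl mul1r; apply: shift_invariantD.
case: z => k; first exact: Fnat.
by rewrite NegzE mulNr; apply: shift_invariantN.
Qed.

(** The shifts leaving [F] invariant form a subgroup of the integers. For [F] the map [porbit s],
    invariance under 1 means a single cycle. *)
Lemma shift_invariant_gcd c d :
  shift_invariant c -> shift_invariant d -> shift_invariant (gcdz c d).
Proof.
move=> Fc Fd; have [u [v <-]] := Bezoutz c d.
by apply: shift_invariantD; apply: shift_invariantM.
Qed.

Lemma shift_invariant1 : shift_invariant 1 -> forall v w, F v = F w.
Proof.
move=> F1 v w; rewrite -[v](addrNK w) addrC (intr_Zp_surj (v - w)).
by have := @shift_invariantM _ ((v - w)%R : nat)%:Z F1 w; rewrite mulr1.
Qed.

End ShiftInvariance.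

(** For the converse, [n - 1] further shifts by [c] lead from [v + c] back to [v]. *)
Lemma implied_shift_invariant (n : nat) (F : 'Z_n -> bool) (c : int) :
    (1 < n)%N -> (forall v, F v -> F (v + c%:~R)) ->
  shift_invariant F c.
Proof.
move=> n_gt1 Fc v; apply/idP/idP => [|/Fc//].
have Fm m w : F w -> F (w + c%:~R *+ m).
  elim: m => [|m IH]; first by rewrite addr0.
  by move=> /IH /Fc; rewrite mulrSr addrA.
move=> /(Fm n.-1); rewrite -addrA -mulrS prednK ?(ltn_trans _ n_gt1) //.
by rewrite -mulr_natr pchar_Zp // mulr0 addr0.
Qed.

Lemma card_porbits1 (T : finType) (s : {perm T}) (x0 : T) :
  (forall u v, porbit s u = porbit s v) <-> #|porbits s| = 1%N.
Proof.
split=> [one|/eqP/cards1P[C defC] u v].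
  suffices -> : porbits s = [set porbit s x0] by rewrite cards1.
  apply/setP => C; rewrite inE; apply/imsetP/eqP => [[y _ ->]|->]; first exact: one.
  by exists x0.
have inC w : porbit s w = C.
  by apply/set1P; rewrite -defC; apply: imset_f.
by rewrite !inC.
Qed.

(** * Translations as permutations *)

Definition shift (n : nat) (c : 'Z_n) : {perm 'Z_n} := perm (addIr c).

Lemma shiftE n (c x : 'Z_n) : shift c x = x + c.
Proof. exact: permE. Qed.

Lemma shiftX n (c x : 'Z_n) m : (shift c ^+ m)%g x = x + c *+ m.
Proof.
elim: m => [|m IH]; first by rewrite expg0 perm1 addr0.
by rewrite expgSr permM IH shiftE mulrSr addrA.
Qed.

Lemma porbit_shift n (c : int) :
  shift_invariant (porbit (shift (c%:~R : 'Z_n))) c.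
Proof. by move=> v; rewrite -shiftE porbit_step. Qed.

Lemma card_Zn n : (1 < n)%N -> #|'Z_n| = n.
Proof. by move=> n_gt1; rewrite card_ord Zp_cast. Qed.

(** A power of the shift by 1, an [n]-cycle, which is odd exactly when [n] is even. *)
Lemma odd_shift n (c : 'Z_n) : (1 < n)%N ->
  odd_perm (shift c) = odd c && ~~ odd n.
Proof.
move=> n_gt1; pose t := shift (1 : 'Z_n).
have -> : shift c = (t ^+ c)%g.
  by apply/permP => x; rewrite shiftX shiftE natr_Zp.
have -> m : odd_perm (t ^+ m)%g = odd m && odd_perm t.
  elim: m => [|m IH]; first by rewrite expg0 odd_perm1.
  by rewrite expgSr odd_permM IH /=; case: (odd m); case: odd_perm.
rewrite /odd_perm card_Zn //.
have /card_porbits1 -> // : forall u v, porbit t u = porbit t v.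
  by apply: shift_invariant1; exact: (@porbit_shift n 1).
by rewrite addbT; case: (odd c); case: (odd n).
Qed.

Lemma odd_intr_Zp n (z : int) : (1 < n)%N -> ~~ odd n ->
  odd (z%:~R : 'Z_n) = ~~ (2 %| z)%Z.
Proof.
move=> n_gt1 n_even.
have : (n %| ((z%:~R : 'Z_n) : nat)%:Z - z)%Z.
  by rewrite -intr_Zp_eq0 // mulrzBr -intr_Zp_surj subrr.
have n2 : (2 %| n%:Z)%Z by lia.
by move=> /(dvdz_trans n2); move: (nat_of_ord _) => m; lia.
Qed.

(** * The circulant digraph *)

Section Circulant.

Variables (k : nat) (a b : int).
Hypothesis k_gt0 : (0 < k)%N.

Local Notation G := 'Z_(2 * k).
Local Notation h := ((k%:Z)%:~R : G).
Local Notation arc := (Cay (n := (2 * k)%N) [:: a; b; b + k%:Z]).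

Lemma double_gt1 : (1 < 2 * k)%N.
Proof. by lia. Qed.

Lemma arcP (v w : G) :
  reflect [\/ w = v + a%:~R, w = v + b%:~R | w = v + b%:~R + h] (arc v w).
Proof.
rewrite /Cay /= orbF mulrzDr addrA.
by apply: (iffP or3P) => -[] => [/eqP|/eqP|/eqP|->|->|->]; by [constructor|rewrite eqxx; constructor].
Qed.

Lemma half_double : h + h = 0.
Proof.
apply/eqP; rewrite -mulrzDr intr_Zp_eq0 ?double_gt1 //.
by rewrite -PoszD addnn -mul2n.
Qed.

Lemma halfK : involutive (fun v : G => v + h).
Proof. by move=> v; rewrite -addrA half_double addr0. Qed.

Lemma half_neq0 : h != 0.
Proof.
rewrite intr_Zp_eq0 ?double_gt1 // dvdzE; apply/negP => /(dvdn_leq k_gt0) /=.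
by lia.
Qed.

Lemma add_half_neq (v : G) : v + h != v.
Proof. by rewrite -subr_eq0 addrAC subrr add0r half_neq0. Qed.

Lemma ham_gcd_a : gcdz a (2 * k)%N%:Z = 1 -> has_hamiltonian_circuit arc.
Proof.
move=> gcd1; pose s := shift (a%:~R : G).
apply: (@ham_of_perm _ _ _ s id 0) => [|y|v|]; first exact: inj_id.
- by exists y.
- by apply/arcP; constructor 1; rewrite shiftE.
apply: shift_invariant1; rewrite -gcd1; apply: shift_invariant_gcd.
  exact: porbit_shift.
move=> v; rewrite (_ : _%:~R = 0) ?addr0 //; apply/eqP.
by rewrite intr_Zp_eq0 ?double_gt1.
Qed.

(** Start from the shift by [b]; every pair may exchange its images. After merging, the cycles are
    invariant under [k] and, following the arcs, under [b]. *)
Lemma ham_gcd_b : gcdz b k = 1 -> has_hamiltonian_circuit arc.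
Proof.
move=> gcd1.
have [s [sE joined]] := @exists_swapped_perm _ (shift (b%:~R : G)) _ xpredT
  halfK (fun=> erefl).
have {}sE v : s v = v + b%:~R \/ s v = v + b%:~R + h.
  by have [->|[_ ->]] := sE v; rewrite shiftE; [left|right; rewrite addrAC].
have Fk : shift_invariant (porbit s) k by move=> v; exact: joined.
apply: (@ham_of_perm _ _ _ s id 0) => [|y|v|]; first exact: inj_id.
- by exists y.
- by apply/arcP; have [->|->] := sE v; [constructor 2|constructor 3].
apply: shift_invariant1; rewrite -gcd1; apply: shift_invariant_gcd => // v.
by rewrite -[RHS]porbit_step; have [->|->] := sE v; rewrite ?Fk.
Qed.

(** * Projection onto the pairs {v, v + k} *)

Hypothesis k_gt1 : (1 < k)%N.

Local Notation pi := (@reduce (2 * k) k).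
Local Notation lift := (@reduce k (2 * k)).

Lemma pi_int (z : int) : pi z%:~R = z%:~R.
Proof. by apply: reduce_int; rewrite ?double_gt1 // dvdn_mull. Qed.

Lemma piD (v w : G) : pi (v + w) = pi v + pi w.
Proof. by apply: reduceD; rewrite ?double_gt1 // dvdn_mull. Qed.

Lemma pi_half : pi h = 0.
Proof. by rewrite pi_int; apply/eqP; rewrite intr_Zp_eq0. Qed.

Lemma pi_lift w : pi (lift w) = w.
Proof. by rewrite /lift pmulrn pi_int -intr_Zp_surj. Qed.

Lemma pi_eq (v w : G) : pi v = pi w -> v = w \/ v = w + h.
Proof.
rewrite (intr_Zp_surj v) (intr_Zp_surj w) !pi_int => /eqP.
rewrite -subr_eq0 -mulrzBr intr_Zp_eq0 // => k_dvd.
have : ((2 * k)%N %| (v : nat)%:Z - (w : nat)%:Z)%Z \/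
       ((2 * k)%N %| (v : nat)%:Z - ((w : nat)%:Z + k%:Z))%Z.
  have /dvdzP[q qE] := k_dvd; have [q2|q2] := boolP (2 %| q)%Z; [left|right].
    by have /dvdzP[r rE] := q2; apply/dvdzP; exists r; lia.
  have : (2 %| q - 1)%Z by lia.
  by move=> /dvdzP[r rE]; apply/dvdzP; exists r; lia.
rewrite -!intr_Zp_eq0 ?double_gt1 // !mulrzBr mulrzDr !subr_eq0.
by move=> []/eqP ->; [left|right].
Qed.


Lemma pi_add_half (v : G) : pi (v + h) = pi v.
Proof. by rewrite piD pi_half addr0. Qed.

Lemma pi_half_bool (c : bool) : pi (h *+ c) = 0.
Proof. by case: c; [exact: pi_half|exact: (pi_int 0)]. Qed.

(* The representative in [0, k) of the pair {v, v + k}. *)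
Definition low (v : G) : G := lift (pi v).

Lemma low_cases v : low v = v \/ low v = v + h.
Proof. by apply: pi_eq; rewrite pi_lift. Qed.

Lemma low_half v : low (v + h) = low v.
Proof. by rewrite /low pi_add_half. Qed.

Lemma lowK v : low (low v) = low v.
Proof. by rewrite /low pi_lift. Qed.

Lemma lowD v w c : low v = low w -> low (v + c) = low (w + c).
Proof. by move=> /(congr1 pi); rewrite !pi_lift /low !piD => ->. Qed.

(** * Condition (i) *)

Section CommonDivisor.

Hypothesis connected : gcdz (gcdz a b) k = 1.
Hypothesis gcd_neq1 : gcdz (a - b) k <> 1.

Let d : nat := absz (gcdz (a - b) k).

Lemma class_gt1 : (1 < d)%N.
Proof.
have d_gt0 : (0 < d)%N by rewrite /d absz_gt0 gcdz_eq0 negb_and; lia.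
have dN1 : d != 1%N by apply/eqP => d1; apply: gcd_neq1; rewrite -[LHS]/(d%:Z) d1.
by lia.
Qed.

Lemma class_dvd_k : (d %| k)%N.
Proof. by have := dvdz_gcdr (a - b) k; rewrite dvdzE. Qed.

Local Notation cls := (@reduce (2 * k) d).
Local Notation a' := (a%:~R : 'Z_d).

Let dvd2 : (d %| 2 * k)%N.
Proof. by apply: dvdn_mull; exact: class_dvd_k. Qed.

Lemma cls_int (z : int) : cls z%:~R = z%:~R.
Proof. by apply: reduce_int; rewrite ?double_gt1 ?class_gt1. Qed.

Lemma clsD (v w : G) : cls (v + w) = cls v + cls w.
Proof. by apply: reduceD; rewrite ?double_gt1 ?class_gt1. Qed.

Lemma cls_add_half v : cls (v + h) = cls v.
Proof.
rewrite clsD cls_int; suffices /eqP -> : (k%:Z)%:~R == 0 :> 'Z_d by rewrite addr0.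
by rewrite intr_Zp_eq0 ?class_gt1 // dvdzE class_dvd_k.
Qed.

Lemma cls_b : (b%:~R : 'Z_d) = a'.
Proof.
apply/esym/eqP; rewrite -subr_eq0 -mulrzBr intr_Zp_eq0 ?class_gt1 //.
by rewrite /d dvdzE abszE /= dvdn_gcdl.
Qed.

Lemma cls_low v : cls (low v) = cls v.
Proof. by have [->|->] := low_cases v; rewrite ?cls_add_half. Qed.

Lemma cls_a_neq0 : a' != 0.
Proof.
apply/negP => a0; have: (d %| 1%R)%Z.
  rewrite -connected !dvdz_gcd -!intr_Zp_eq0 ?class_gt1 // cls_b a0 /=.
  by rewrite intr_Zp_eq0 ?class_gt1 // dvdzE class_dvd_k.
by rewrite dvdzE dvdn1; have := class_gt1; lia.
Qed.

(* Only the pairs of class [- a] use the arc of length [a], from their lower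
   vertex; the upper one goes to the vertex of its target pair left free. *)
Definition split_fun (v : G) : G :=
  if cls v == - a' then
    if low v == v then v + a%:~R else low (v - (a - b)%:~R) + h + a%:~R
  else v + b%:~R.

Lemma cls_split_fun v : cls (split_fun v) = cls v + a'.
Proof.
rewrite /split_fun; case: ifP => _; last by rewrite clsD cls_int cls_b.
case: ifP => _; first by rewrite clsD cls_int.
rewrite clsD cls_add_half cls_low cls_int clsD -mulrNz cls_int mulrNz mulrzBr.
by rewrite cls_b subrr oppr0 addr0.
Qed.

(** All images raise the class by [a'], so a collision stays within one class. In the class [- a'],
    lower and upper vertices cannot collide, as [low x] is never [low y + h]. *)
Lemma split_fun_inj : injective split_fun.
Proof.
move=> v w e; have ecls : cls v = cls w.
  by apply: (addIr a'); rewrite -!cls_split_fun e.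
move: e; rewrite /split_fun ecls; case: ifP => _; last exact: addIr.
have mixed_case x y : low x = x -> x + a%:~R = low y + h + a%:~R -> False.
  move=> lx /addIr xE; have := add_half_neq x.
  by rewrite -{1}lx {1}xE low_half lowK xE eqxx.
case: ifP => [/eqP lv|nv]; case: ifP => [/eqP lw|nw].
- exact: addIr.
- by move/(mixed_case _ _ lv).
- by move/esym/(mixed_case _ _ lw).
move=> /addIr /addIr /lowD-/(_ (a - b)%:~R); rewrite !addrNK => e.
have [lv|lv] := low_cases v; first by rewrite lv eqxx in nv.
have [lw|lw] := low_cases w; first by rewrite lw eqxx in nw.
by move: e; rewrite lv lw => /addIr.
Qed.

Lemma ham_common_divisor : has_hamiltonian_circuit arc.
Proof.
pose P := [pred v : G | cls v != - a'].
have P_half v : P (v + h) = P v by rewrite /P /= cls_add_half.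
have [s [sE joined]] := exists_swapped_perm (perm split_fun_inj) halfK P_half.
have sP v : P v -> s v = v + b%:~R \/ s v = v + b%:~R + h.
  move=> Pv; have Pn := negPf Pv.
  have [->|[_ ->]] := sE v; rewrite permE /split_fun ?cls_add_half Pn.
    by left.
  by right; rewrite addrAC.
have sN v : ~~ P v -> s v = split_fun v.
  by move=> /negPf NP; have [->|[]] := sE v; rewrite ?permE ?NP.
have s_low v : ~~ P v -> s (low v) = low v + a%:~R.
  move=> NP; rewrite sN /split_fun ?lowK ?eqxx /= cls_low.
    by rewrite /= negbK in NP; rewrite NP.
  by [].
have s_high v : ~~ P v ->
    s (low v + h) = v + b%:~R \/ s (low v + h) = v + b%:~R + h.
  move=> NP; rewrite sN /= ?cls_add_half ?cls_low // /split_fun.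
  rewrite cls_add_half cls_low; rewrite /= negbK in NP; rewrite NP.
  rewrite low_half lowK eq_sym (negPf (add_half_neq _)).
  have -> : low (low v + h - (a - b)%:~R) = low (v - (a - b)%:~R).
    by apply: lowD; rewrite low_half lowK.
  have shiftab (x : G) : x - (a - b)%:~R + a%:~R = x + b%:~R.
    by rewrite mulrzBr opprB addrA addrNK.
  have [->|->] := low_cases (v - (a - b)%:~R); last rewrite halfK.
    by right; rewrite -[in RHS]shiftab addrAC.
  by left.
have arcs v : arc v (s v).
  apply/arcP; have [Pv|NP] := boolP (P v).
    by have [->|->] := sP v Pv; [constructor 2|constructor 3].
  have [lv|lv] := low_cases v.
    by constructor 1; rewrite -{1}lv s_low // lv.
  have -> : v = low v + h by rewrite lv halfK.
  by have [->|->] := s_high v NP; rewrite lv; [constructor 2|constructor 3]; rewrite halfK.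
pose F v := porbit s v.
have Fs v : F (s v) = F v := porbit_step s v.
have cls_s v : cls (s v) = cls v + a'.
  have [->|[_ ->]] := sE v; rewrite permE cls_split_fun //.
  by rewrite cls_add_half.
(* A pair of class [- a'] cannot be exchanged, but it is the image of a pair [u], [u + h] of another
   class, as [a'] is not 0, and that pair is joined. *)
have Fk : shift_invariant F k.
  move=> v; have [Pv|NP] := boolP (P v); first exact: joined.
  have [u vE] : exists u, v = s u by exists (s^-1 v)%g; rewrite permKV.
  have Pu : P u.
    rewrite /P /=; apply: contra cls_a_neq0 => /eqP cu.
    by move: NP; rewrite /P /= vE cls_s cu addNr negbK eq_sym oppr_eq0.
  have ne : s (u + h) <> s u.
    by move/perm_inj/eqP; rewrite (negPf (add_half_neq u)).
  have Puh : P (u + h) by rewrite P_half.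
  suffices <- : s (u + h) = v + h by rewrite vE !Fs; exact: joined.
  move: ne; rewrite vE; have [->|->] := sP _ Pu; have [->|->] := sP _ Puh.
  - by rewrite addrAC.
  - by rewrite [u + h + _]addrAC halfK.
  - by rewrite addrAC.
  - by rewrite [u + h + _]addrAC !halfK.
have Fh (v : G) : F (v + h) = F v := Fk v.
have Flow v : F (low v) = F v by have [->|->] := low_cases v; rewrite ?Fh.
have Fb : shift_invariant F b.
  move=> v; have [Pv|NP] := boolP (P v).
    by rewrite -[RHS]Fs; have [->|->] := sP v Pv; rewrite ?Fh.
  have := Fs (low v + h); rewrite Fh Flow => <-.
  by have [->|->] := s_high v NP; rewrite ?Fh.
have Fa v : ~~ P v -> F (v + a%:~R) = F v.
  move=> NP; rewrite -[RHS]Flow -[RHS]Fs s_low //.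
  by have [->|->] := low_cases v; rewrite // addrAC Fh.
have [u [w bezout_b]] : exists u w, u * b + w * d%:Z = 1.
  have [u [w uw]] := Bezoutz b d; exists u, w; rewrite uw.
  have g1 : (gcdz b d %| 1%R)%Z.
    rewrite -connected !dvdz_gcd dvdz_gcdl andbT.
    have bd := dvdz_gcdr b d; have bb := dvdz_gcdl b d.
    have dab : (d %| a - b)%Z by rewrite /d dvdzE abszE /= dvdn_gcdl.
    have dk : (d %| k%:Z)%Z by rewrite dvdzE class_dvd_k.
    rewrite (dvdz_trans bd dk) andbT -[a](subrK b).
    by rewrite rpredD // (dvdz_trans bd dab).
  by move: g1; rewrite dvdzE dvdn1 /gcdz absz_nat => /eqP ->.
(* Since [u] inverts [b] modulo [d], adding [z * b - b] carries [v] to the class [- a'], where an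
   arc of length [a] leaves the pair; [F] does not notice multiples of [b]. *)
have Fg : shift_invariant F (a - b).
  move=> v; pose z := - ((v : nat)%:Z * u).
  have Fzb := shift_invariantM z Fb.
  pose v0 := v + (z * b)%:~R - b%:~R.
  have NP0 : ~~ P v0.
    rewrite /P /= negbK /v0 -mulrNz !clsD !cls_int [v]intr_Zp_surj cls_int.
    rewrite mulrNz cls_b -[X in _ == X]add0r; apply/eqP; congr (_ - _).
    apply/eqP; rewrite -mulrzDr intr_Zp_eq0 ?class_gt1 //.
    apply/dvdzP; exists ((v : nat)%:Z * w); rewrite /z.
    by rewrite -[X in X + _]mulr1 -bezout_b; ring.
  have := Fa _ NP0; rewrite /v0 -[RHS]Fb addrNK Fzb => <-.
  rewrite -[LHS]Fzb mulrzBr; congr (F _); ring.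
apply: (@ham_of_perm _ _ _ s id 0) => //; first by move=> y; exists y.
apply: shift_invariant1; rewrite -connected.
apply: shift_invariant_gcd => //; apply: shift_invariant_gcd => //.
by rewrite -[a](subrK b); apply: shift_invariantD.
Qed.

End CommonDivisor.


(** * Pairs with exactly one arc of length a *)

Local Notation al := (shift (a%:~R : 'Z_k)).
Local Notation be := (shift (b%:~R : 'Z_k)).

(* [s w] is the vertex of the pair over [w] that is left by the arc of length
   [a], and [f w] tells that the vertex entered by such an arc is the other one
   of that pair. *)
Definition is_section (s : {ffun 'Z_k -> G}) (f : {ffun 'Z_k -> bool}) :=
  [forall w, (pi (s w) == w) &&
             (s w == s (w - a%:~R) + a%:~R + h *+ f w)].

(** The vertex that a state stands for: with [true], the head of the arc of length [a] into the
    pair; with [false], the other vertex of the pair. *)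
Definition visit (s : {ffun 'Z_k -> G}) (v : 'Z_k * bool) : G :=
  s (v.1 - a%:~R) + a%:~R + h *+ ~~ v.2.

Section OneSection.

Variables (s : {ffun 'Z_k -> G}) (f : {ffun 'Z_k -> bool}).
Hypothesis sf : is_section s f.

Lemma pi_section w : pi (s w) = w.
Proof. by have /forallP/(_ w)/andP[/eqP] := sf. Qed.

Lemma section_next w : s w = s (w - a%:~R) + a%:~R + h *+ f w.
Proof. by have /forallP/(_ w)/andP[_ /eqP] := sf. Qed.

(* Sum [section_next] over all [w]. *)
Lemma odd_section : odd (\sum_w f w) = ~~ (2 %| a)%Z.
Proof.
set N := (\sum_w f w)%N.
have sum_s : \sum_w s w = \sum_w s w + ((a * k%:Z + k%:Z * N%:Z)%:~R : G).
  rewrite {1}(eq_bigr _ (fun w _ => section_next w)) !big_split /=.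
  have -> : \sum_w s (w - a%:~R) = \sum_w s w.
    by rewrite [RHS](reindex_inj (addIr (- (a%:~R : 'Z_k)))).
  rewrite -addrA; congr (_ + _); rewrite mulrzDr sumr_const card_Zn //.
  by rewrite sumrMnr !mulrzA -!pmulrn.
have : ((2 * k)%N %| a * k%:Z + k%:Z * N%:Z)%Z.
  rewrite -intr_Zp_eq0 ?double_gt1 //; apply/eqP.
  by apply: (addrI (\sum_w s w)); rewrite -sum_s addr0.
move=> /dvdzP[q qE].
have : a + N%:Z = q * 2.
  apply: (mulfI (_ : k%:Z != 0)); first by lia.
  by rewrite mulrDr [k%:Z * a]mulrC qE PoszM; ring.
by lia.
Qed.

Lemma pi_visit v : pi (visit s v) = v.1.
Proof.
by rewrite /visit !piD pi_section pi_int addrNK pi_half_bool addr0.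
Qed.

(** The vertex seen from its exit: it leaves by the arc of length [a] exactly when [v.2 (+) f v.1]
    holds, in agreement with [step]. *)
Lemma visitE v : visit s v = s v.1 + h *+ ~~ (v.2 (+) f v.1).
Proof.
rewrite /visit (section_next v.1) -[RHS]addrA -mulrnDr; congr (_ + _).
by case: v.2; case: (f _); rewrite //= ?addn0 ?mulr2n ?half_double.
Qed.

Lemma visit_inj : injective (visit s).
Proof.
move=> v w e; have e1 : v.1 = w.1 by rewrite -!pi_visit e.
case: v w e1 e => [i t] [j u] /= ij; rewrite {}ij /visit /= => /addrI.
by case: t; case: u => //= e; case/eqP: half_neq0; [exact: esym e|exact: e].
Qed.

Lemma visit_surj y : exists v, y = visit s v.
Proof.
have [->|->] : y = visit s (pi y, true) \/ y = visit s (pi y, true) + h.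
- by apply: pi_eq; rewrite pi_visit.
- by exists (pi y, true).
- by exists (pi y, false); rewrite /visit /= addr0.
Qed.

Lemma arc_visit v : arc (visit s v) (visit s (step al be f v)).
Proof.
rewrite stepE /step_fun visitE; set t := v.2 (+) f v.1.
apply/arcP; case tE: t.
  by constructor 1; rewrite /visit /= shiftE addrK /= !addr0.
have : pi (visit s (be v.1, false)) = pi (s v.1 + h *+ ~~ false + b%:~R).
  by rewrite pi_visit !piD pi_section pi_half addr0 shiftE pi_int.
by move=> /pi_eq[]->; [constructor 2|constructor 3].
Qed.

(** The number [2 * k] of states is even, so the number of cycles has the parity of [step], where
    [f] enters only through its sum. When gcd(a, b, k) = 1, the right side says that (iv) or (v)
    holds. *)
Lemma odd_ncycles : odd (ncycles al be f) =
  ~~ (2 %| a)%Z (+) (~~ odd k && (~~ (2 %| a)%Z (+) ~~ (2 %| b)%Z)).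
Proof.
have := odd_step al be f; rewrite odd_section !odd_shift // /odd_perm /ncycles.
rewrite card_prod card_bool muln2 odd_double /= => ->.
by case: (boolP (odd k)) => /= ko; rewrite ?andbF // !andbT !odd_intr_Zp.
Qed.

End OneSection.

Lemma shift_transitive (connected : gcdz (gcdz a b) k = 1) (i j : 'Z_k) :
  exists m n, j = (al ^+ m)%g ((be ^+ n)%g i).
Proof.
have [u [v uvE]] := Bezoutz a b; have [x [y xyE]] := Bezoutz (gcdz a b) k.
rewrite connected -uvE in xyE.
(* Bezout coefficients may be negative; their residues modulo [k] serve as exponents. *)
pose m : 'Z_k := (j - i) * (x * u)%:~R; pose n : 'Z_k := (j - i) * (x * v)%:~R.
exists m, n; rewrite !shiftX -[_ *+ m]mulr_natr -[_ *+ n]mulr_natr !natr_Zp.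
have k0 : (k%:Z)%:~R = 0 :> 'Z_k by apply/eqP; rewrite intr_Zp_eq0.
have e1 : (x * u)%:~R * a%:~R + (x * v)%:~R * b%:~R = 1 :> 'Z_k.
  rewrite -!intrM -intrD -[RHS]/(1%:~R) -xyE [in RHS]intrD [(y * k)%:~R]intrM k0 mulr0 addr0.
  by congr (_%:~R); rewrite mulrDr !mulrA.
have swap (c z : int) : c%:~R * ((j - i) * z%:~R) = (j - i) * (z%:~R * c%:~R).
  by rewrite mulrCA [c%:~R * _]mulrC.
by rewrite /m /n !swap -addrA -mulrDr addrC [_ + _ * a%:~R]addrC e1 mulr1 subrK.
Qed.

Lemma ham_odd (connected : gcdz (gcdz a b) k = 1) : ~~ (k %| a)%Z ->
    ~~ (2 %| a)%Z (+) (~~ odd k && (~~ (2 %| a)%Z (+) ~~ (2 %| b)%Z)) ->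
  has_hamiltonian_circuit arc.
Proof.
move=> na par.
pose Q := [pred f | [exists s, is_section s f]].
have commute_ab (i : 'Z_k) : al (be i) = be (al i) by rewrite !shiftE addrAC.
pose s0 : {ffun 'Z_k -> G} := [ffun w => lift w].
pose f0 : {ffun 'Z_k -> bool} :=
  [ffun w => s0 w != s0 (w - a%:~R) + a%:~R].
have Qf0 : Q f0.
  apply/existsP; exists s0; apply/forallP => w; rewrite /f0 !ffunE pi_lift eqxx /=.
  have : lift w = lift (w - a%:~R) + a%:~R \/
         lift w = lift (w - a%:~R) + a%:~R + h.
    by apply: pi_eq; rewrite piD !pi_lift pi_int subrK.
  by case=> ->; rewrite ?add_half_neq eqxx /= ?addr0.
(* Moving the section at [i] to the other vertex of its pair changes [f] at [i] and at [al i]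
   only. *)
have toggleQ f i : Q f -> Q (toggle i (toggle (al i) f)).
  move=> /existsP[s /forallP sf]; apply/existsP.
  exists [ffun w => s w + h *+ (w == i)]; apply/forallP => w.
  have /andP[/eqP pw /eqP sw] := sf w; rewrite !ffunE.
  apply/andP; split.
    by rewrite piD pw pi_half_bool addr0.
  rewrite shiftE; apply/eqP; rewrite {1}sw -[w == i + _]subr_eq -!addrA.
  congr (_ + _); rewrite [RHS]addrCA; congr (_ + _); rewrite -!mulrnDr.
  by case: (f w); case: (w == i); case: (w - _ == i);
    rewrite /= ?mulr2n ?half_double.
have al_free i : al i != i.
  rewrite shiftE -subr_eq0 addrAC subrr add0r.
  by rewrite intr_Zp_eq0.
have oddQ f : Q f -> odd (ncycles al be f).
  by move=> /existsP[s sf]; rewrite (odd_ncycles sf).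
have [f /existsP[s sf] /card_porbits1 one] :=
  exists_single_cycle commute_ab (shift_transitive connected) toggleQ al_free oddQ Qf0.
apply: ham_of_perm (0, true) (visit_inj sf) (visit_surj sf) (arc_visit sf) _.
by apply: one; exact: (0, true).
Qed.

(** * Necessity of the conditions *)

Lemma connected_of_ham : has_hamiltonian_circuit arc ->
  gcdz (gcdz a b) k = 1.
Proof.
move=> /perm_of_ham[s arcs one]; set e := gcdz _ _.
have [ea [eb ek]] : (e %| a)%Z /\ (e %| b)%Z /\ (e %| k%:Z)%Z.
  have e1 := dvdz_gcdl (gcdz a b) k; rewrite dvdz_gcdr.
  by split; [|split=> //]; apply: dvdz_trans e1 _; rewrite ?dvdz_gcdl ?dvdz_gcdr.
have reach m : exists2 z, (s ^+ m)%g 0 = z%:~R & (e %| z)%Z.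
  elim: m => [|m [z zE ez]]; first by exists 0; rewrite ?expg0 ?perm1.
  rewrite expgSr permM zE.
  have /arcP[->|->|->] := arcs z%:~R.
  - by exists (z + a); rewrite ?intrD // rpredD.
  - by exists (z + b); rewrite ?intrD // rpredD.
  - by exists (z + b + k%:Z); rewrite ?intrD // !rpredD.
have : 1 \in porbit s 0 by rewrite (one 0 1) porbit_id.
move=> /porbitP[m]; case: (reach m) => z -> ez /eqP.
rewrite -[1]/(1%:~R) -subr_eq0 -mulrzBr intr_Zp_eq0 ?double_gt1 // => e2k.
have e1 : (e %| 1%R)%Z.
  rewrite -[1](subrK z) rpredD // (dvdz_trans _ e2k) // PoszM.
  exact: dvdz_mull.
by move: e1; rewrite dvdzE dvdn1 /e /gcdz absz_nat => /eqP ->.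
Qed.

Lemma ham_necessary : gcdz (a - b) k = 1 -> has_hamiltonian_circuit arc ->
  [\/ gcdz a (2 * k)%N%:Z = 1, gcdz b k%:Z = 1 |
      ~~ (2 %| a)%Z (+) (~~ odd k && (~~ (2 %| a)%Z (+) ~~ (2 %| b)%Z))].
Proof.
move=> gcd1 /perm_of_ham[s arcs one].
pose at_a v := s v == v + a%:~R.
have sb v : ~~ at_a v -> s v = v + b%:~R \/ s v = v + b%:~R + h.
  by move=> /eqP nv; have /arcP[/nv|->|->] := arcs v; [|left|right].
have ab_neq0 : ((a - b)%:~R : 'Z_k) != 0.
  rewrite intr_Zp_eq0 //; apply/negP => k_dvd.
  have : (k %| 1%R)%Z by rewrite -gcd1 dvdz_gcd k_dvd dvdzz.
  by rewrite dvdzE dvdn1 /=; lia.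
have not_half (v w : G) : w = v + (a - b)%:~R -> v <> w /\ v <> w + h.
  move=> wE; split=> /(congr1 pi); rewrite wE ?pi_add_half piD pi_int;
    by move=> /eqP; rewrite eq_sym -subr_eq0 addrAC subrr add0r (negPf ab_neq0).
have ab_shift (v : G) : v + (a - b)%:~R + b%:~R = v + a%:~R.
  by rewrite -addrA -mulrzDr subrK.
(* If [v] and [v + h] both use [a], they occupy all heads of arcs of length [b] and [b + k] from the
   pair of [v + (a - b)], which must then use [a] as well. *)
have both : shift_invariant (fun v => at_a v && at_a (v + h)) (a - b).
  apply: implied_shift_invariant double_gt1 _ => v /andP[/eqP e1 /eqP e2].
  have hit w : w = v + (a - b)%:~R \/ w = v + (a - b)%:~R + h -> at_a w.
    move=> wE; apply/negPn/negP => /sb.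
    have wb : w + b%:~R = v + a%:~R \/ w + b%:~R = v + a%:~R + h.
      by case: wE => ->; rewrite ?[_ + h + _]addrAC ab_shift; [left|right].
    have : s w = s v \/ s w = s (v + h) -> False.
      have [n1 n2] := not_half v _ erefl.
      case=> /perm_inj; case: wE => e wv; rewrite {}wv in e.
      - exact: n1 e.
      - exact: n2 e.
      - by apply: n2; rewrite -e halfK.
      - by apply: n1; apply: addIr e.
    rewrite e1 e2 [v + h + _]addrAC => no sw; apply: no.
    by case: sw => ->; case: wb => ->; rewrite ?halfK; [left|right|right|left].
  by rewrite !hit; [|right|left].
(* Dually, a pair without arcs of length [a] occupies the heads of such arcs from the pair of
   [v - (a - b)]. *)
have none : shift_invariant (fun v => ~~ at_a v && ~~ at_a (v + h)) (- (a - b)).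
  apply: implied_shift_invariant double_gt1 _ => v /andP[/sb e1 /sb e2].
  have miss w : w + (a - b)%:~R = v \/ w + (a - b)%:~R = v + h -> ~~ at_a w.
    move=> wE; apply/eqP => sw.
    have wa : w + a%:~R = v + b%:~R \/ w + a%:~R = v + b%:~R + h.
      by rewrite -ab_shift; case: wE => ->; rewrite ?[_ + h + _]addrAC; [left|right].
    have : s w = s v \/ s w = s (v + h) -> False.
      have [n1 n2] := not_half w _ erefl.
      case=> /perm_inj wv; case: wE => e.
      - by apply: n1; rewrite e.
      - by apply: n2; rewrite e halfK.
      - by apply: n2; rewrite e.
      - by apply: n1; rewrite e.
    apply; rewrite sw; have ne : s v <> s (v + h).
      by move=> /perm_inj/esym/eqP; rewrite (negPf (add_half_neq v)).
    move: ne; rewrite [v + h + _]addrAC ?halfK in e2 *.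
    by case: e1 => ->; case: e2 => ->; case: wa => ->; rewrite ?halfK;
      by [left|right|move=> /(_ erefl)].
  rewrite !miss // ?mulrNz; first by right; rewrite addrAC addrNK.
  by left; rewrite addrNK.
have half_inv (F : G -> bool) : shift_invariant F (a - b) ->
    (forall v, F (v + h) = F v) -> forall v w, F v = F w.
  by move=> F1 F2; apply: shift_invariant1; rewrite -gcd1;
     apply: shift_invariant_gcd.
have {}both : forall v w, at_a v && at_a (v + h) = at_a w && at_a (w + h).
  by apply: (half_inv _ both) => v; rewrite halfK andbC.
have {}none : forall v w,
    ~~ at_a v && ~~ at_a (v + h) = ~~ at_a w && ~~ at_a (w + h).
  have := shift_invariantN none; rewrite opprK => /half_inv; apply => v.
  by rewrite halfK andbC.
have [m one_m] : exists m, 1 = (s ^+ m)%g 0.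
  by apply/porbitP; rewrite (one 0 1) porbit_id.
have [at0|nat0] := boolP (at_a 0 && at_a (0 + h)).
  constructor 1; have s_a v : s v = v + a%:~R.
    by apply/eqP; have := both v 0; rewrite at0 => /andP[].
  have : (s ^+ m)%g 0 = (a * m%:Z)%:~R.
    elim: (m) => [|l IH]; first by rewrite expg0 perm1 mulr0.
    rewrite expgSr permM IH s_a -mulrzDr; congr (_ *~ _).
    by rewrite -[l.+1]addn1 PoszD mulrDr mulr1.
  rewrite -one_m => /eqP; rewrite -[1]/(1%:~R) -subr_eq0 -mulrzBr.
  rewrite intr_Zp_eq0 ?double_gt1 // => dvd_m; set g := gcdz _ _.
  have g1 : (g %| 1%R)%Z.
    rewrite -[1](subrK (a * m%:Z)) rpredD ?(dvdz_trans _ dvd_m) ?dvdz_gcdr //.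
    by rewrite dvdz_mulr ?dvdz_gcdl.
  by move: g1; rewrite dvdzE dvdn1 /g /gcdz absz_nat => /eqP ->.
have [nat1|at1] := boolP (~~ at_a 0 && ~~ at_a (0 + h)).
  constructor 2; have s_b v : pi (s v) = pi v + b%:~R.
    have := none v 0; rewrite nat1 => /andP[/sb + _].
    by case=> ->; rewrite ?pi_add_half piD pi_int.
  have : pi ((s ^+ m)%g 0) = (b * m%:Z)%:~R.
    elim: (m) => [|l IH]; first by rewrite expg0 perm1 mulr0 (pi_int 0).
    rewrite expgSr permM s_b IH -mulrzDr; congr (_ *~ _).
    by rewrite -[l.+1]addn1 PoszD mulrDr mulr1.
  rewrite -one_m (pi_int 1) => /eqP; rewrite -subr_eq0 -mulrzBr.
  rewrite intr_Zp_eq0 // => dvd_m; set g := gcdz _ _.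
  have g1 : (g %| 1%R)%Z.
    rewrite -[1](subrK (b * m%:Z)) rpredD ?(dvdz_trans _ dvd_m) ?dvdz_gcdr //.
    by rewrite dvdz_mulr ?dvdz_gcdl.
  by move: g1; rewrite dvdzE dvdn1 /g /gcdz absz_nat => /eqP ->.
have mixed_at v : at_a (v + h) = ~~ at_a v.
  have := both v 0; have := none v 0.
  by rewrite (negPf nat0) (negPf at1); case: (at_a v); case: (at_a _).
constructor 3.
pose sec : {ffun 'Z_k -> G} :=
  [ffun w => if at_a (lift w) then lift w else lift w + h].
have sec_at w : at_a (sec w).
  by rewrite ffunE; case: ifP => // /negbT; rewrite mixed_at.
have pi_sec w : pi (sec w) = w.
  by rewrite ffunE; case: ifP; rewrite ?pi_add_half pi_lift.
pose f : {ffun 'Z_k -> bool} := [ffun w => sec w != sec (w - a%:~R) + a%:~R].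
have sf : is_section sec f.
  apply/forallP => w; rewrite pi_sec eqxx [f w]ffunE /=.
  have : sec w = sec (w - a%:~R) + a%:~R \/
         sec w = sec (w - a%:~R) + a%:~R + h.
    by apply: pi_eq; rewrite piD !pi_sec pi_int subrK.
  by case=> ->; rewrite ?add_half_neq eqxx /= ?addr0.
have visit_step v : visit sec (step al be f v) = s (visit sec v).
  rewrite stepE /step_fun (visitE sf v); set t := v.2 (+) f v.1.
  case tE: t.
    rewrite /visit /= shiftE addrK !addr0.
    by rewrite (eqP (sec_at _)).
  set x := sec v.1 + h *+ ~~ false.
  have nx : ~~ at_a x by rewrite /x mixed_at sec_at.
  (* One vertex of the target pair is already the image of [sec w] under the arc of length [a], so
     [x] goes to the other one. *)
  pose w := v.1 + b%:~R - a%:~R.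
  have yE : visit sec (be v.1, false) = s (sec w) + h.
    by rewrite (eqP (sec_at _)) /visit /= shiftE.
  have : s x = visit sec (be v.1, false) \/ s x = visit sec (be v.1, false) + h.
    apply: pi_eq; rewrite (pi_visit sf) /= shiftE.
    by case: (sb x nx) => ->; rewrite ?pi_add_half piD pi_int pi_add_half pi_sec.
  case=> [->//|]; rewrite yE halfK => /perm_inj xw.
  by move: nx; rewrite xw sec_at.
rewrite -(odd_ncycles sf) /ncycles.
suffices /(card_porbits1 _ (0, true)) -> :
  forall u v, porbit (step al be f) u = porbit (step al be f) v by [].
move=> u v; apply/eqP; rewrite eq_porbit_mem porbit_sym; apply/porbitP.
have : visit sec v \in porbit s (visit sec u) by rewrite (one _ (visit sec v)) porbit_id.
move=> /porbitP[l vE]; exists l; apply: (visit_inj sf); rewrite vE.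
elim: (l) => [|l' IH]; first by rewrite !expg0 !perm1.
by rewrite !expgSr !permM visit_step -IH.
Qed.

End Circulant.

(** * The characterization *)

Theorem theorem4p6 (k : nat) (a b : int) (hk : (1 <= k)%N) :
  has_hamiltonian_circuit (Cay (n := (2 * k)%N) [:: a; b; b + k%:Z]) <->
  gcdz (gcdz a b) k%:Z = 1 /\
  (gcdz (a - b) k%:Z <> 1 \/
   gcdz a (2 * k)%N%:Z = 1 \/
   gcdz b k%:Z = 1 \/
   ((2 %| a)%Z /\ (2 %| k%:Z)%Z) \/
   (~ (2 %| a)%Z /\ (~ (2 %| b)%Z \/ ~ (2 %| k%:Z)%Z))).
Proof.
have odd_k : odd k = ~~ (2 %| k%:Z)%Z by lia.
split=> [ham|[connected cond]].
  have connected := connected_of_ham hk ham; split=> //.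
  have [k1|k_gt1] : k = 1%N \/ (1 < k)%N by lia.
    by right; right; left; rewrite k1 /gcdz gcdn1.
  have [g1|/eqP g1] := eqVneq (gcdz (a - b) k) 1; last by left.
  right; have [?|?|] := ham_necessary hk k_gt1 g1 ham; [by left|by right; left|].
  (* Connectedness forbids [a], [b], [k] all even, which turns the parity condition into (iv) or
     (v). *)
  rewrite odd_k; have : ~~ [&& 2 %| a, 2 %| b & 2 %| k%:Z]%Z.
    by apply/negP => /and3P[a2 b2 k2]; have : (2 %| gcdz (gcdz a b) k)%Z;
      [rewrite !dvdz_gcd a2 b2|rewrite connected].
  by case: (2 %| a)%Z; case: (2 %| b)%Z; case: (2 %| k%:Z)%Z => //= _ _;
    right; right; [left|right; split=> //; right|right; split=> //; left|right; split=> //; right].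
have [g1|/eqP g1] := eqVneq (gcdz (a - b) k) 1; last first.
  apply: ham_common_divisor => //; have : k <> 1%N; last by lia.
  by move=> k1; apply: g1; rewrite k1 /gcdz gcdn1.
(* If [k] divides [a], then gcd(b, k) divides gcd(a, b, k), so (iii) holds; otherwise [al] has no
   fixed point, as [ham_odd] requires. *)
have [ka|na] := boolP (k %| a)%Z.
  apply: ham_gcd_b => //; have : (gcdz b k %| 1%R)%Z.
    rewrite -connected !dvdz_gcd dvdz_gcdl dvdz_gcdr andbT.
    by rewrite (dvdz_trans (dvdz_gcdr b k) ka).
  by rewrite dvdzE dvdn1 /gcdz absz_nat => /eqP ->.
case: cond => [//|[|[|cond]]]; [exact: ham_gcd_a|exact: ham_gcd_b|].
have k_gt1 : (1 < k)%N.
  by have : k <> 1%N; [move=> k1; move: na; rewrite k1 dvd1z|lia].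
apply: ham_odd => //; rewrite odd_k.
have : ~~ [&& 2 %| a, 2 %| b & 2 %| k%:Z]%Z.
  by apply/negP => /and3P[a2 b2 k2]; have : (2 %| gcdz (gcdz a b) k)%Z;
    [rewrite !dvdz_gcd a2 b2|rewrite connected].
by case: cond => [[-> ->]|[/negP/negPf-> [/negP/negPf->|/negP/negPf->]]] /=;
  case: (2 %| b)%Z; case: (2 %| k%:Z)%Z.
Qed.
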